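(* Let $\mathbb{F}$ be a complete normed field with the perfect interpolation property, and let $d\ge1$. Suppose $f$ is a formal power series in $d$ variables with coefficients in $\mathbb{F}$ such that, for every $x\in\mathbb{B}^d$, the one-variable series $f(xz)$ has radius of convergence at least $1$ as a function of $z$. Then $f$ defines an analytic function on $\mathbb{B}^d$.
   Context: A norm on a field $\mathbb{F}$ is a function $|\cdot|:\mathbb{F}\to[0,\infty)$ with $|x|=0$ iff $x=0$, $|xy|=|x||y|$, and $|x+y|\le|x|+|y|$; $\mathbb{F}$ is complete if it is complete for the metric $d(x,y)=|x-y|$. Let $\mathbb{B}=\{x\in\mathbb{F}:|x|<1\}$. For a polynomial $h$ over $\mathbb{F}$, $\|h\|$ is the sum of the norms of its coefficients and $\|h\|_Y=\sup_{y\in Y}|h(y)|$. Writing $f=\sum_n h_n$ with $h_n$ homogeneous of degree $n$, $f(xz)$ denotes the one-variable series $\sum_n h_n(x)z^n$; a one-variable series $\sum a_nz^n$ has radius of convergence $1/\limsup|a_n|^{1/n}$. ''$f$ defines an analytic function on $\mathbb{B}^d$'' means that the power series $f$ converges at every point of $\mathbb{B}^d$ and its sum is an analytic function there. $\mathbb{F}$ has the perfect interpolation property if, for every $d$ and every nested (increasing) sequence of closed sets $X_1\subseteq X_2\subseteq\cdots$ with $\bigcup_i X_i=\mathbb{B}^d$, there are a sequence $B_i\to1$ and a sequence $A_i>0$ such that, for all sufficiently large $i$ and every polynomial $h$ in $d$ variables over $\mathbb{F}$, $$\|h\|\le A_i\,B_i^{\deg h}\,\|h\|_{X_i}.$$ 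*)

(* Defs.v *)
From HB Require Import structures.
From mathcomp Require Import all_boot all_order all_algebra finmap.
(* The notations of [mpoly] are incompatible with those of MathComp-Analysis. *)
From mathcomp Require Import -(notations) mpoly.
From mathcomp Require Import boolp classical_sets reals ereal topology.
From mathcomp Require Import normedtype sequences exp.
From mathcomp.analysis.showcase Require summability.

Set Implicit Arguments.
Unset Strict Implicit.
Unset Printing Implicit Defensive.

Import Order.TTheory GRing.Theory Num.Theory.
Import numFieldNormedType.Exports.

Local Open Scope classical_set_scope.
Local Open Scope ring_scope.

(* [Num.NormedZmodule] cannot be used: its axiom |x *+ n| = |x| *+ n excludes
   positive characteristic and non-archimedean norms.  The last axiom says that
   the uniform structure, hence the topology, is that of the metric |x - y|. *)
HB.mixin Record UniformField_isNormed (R : realType) F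
    of GRing.Field F & Uniform F := {
  absv : F -> R;
  absv_ge0 : forall x, 0 <= absv x;
  absv_eq0 : forall x, absv x = 0 <-> x = 0;
  absvM : forall x y, absv (x * y) = absv x * absv y;
  absv_triangle : forall x y, absv (x + y) <= absv x + absv y;
  entourage_absv : entourage = entourage_ (ball_ absv)
}.

#[short(type="normedFieldType")]
HB.structure Definition NormedField (R : realType) :=
  { F of GRing.Field F & Uniform F & UniformField_isNormed R F }.

Definition complete_field (R : realType) (F : normedFieldType R) : Prop :=
  forall u : nat -> F, cauchy (u @ \oo) -> exists l : F, u @ \oo --> l.

Definition coords (F : Type) (d : nat) (x : 'rV[F]_d) : 'I_d -> F :=
  fun j => x 0 j.

Definition unit_polydisc (R : realType) (F : normedFieldType R) (d : nat) :
    set 'rV[F]_d :=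
  [set x | forall j, absv (coords x j) < 1].

Section Polynomials.
Context {R : realType} {F : normedFieldType R} {d : nat}.
Implicit Types (h : mpoly d F).

Definition coef_norm h : R :=
  \sum_(m <- msupp h) absv (mcoeff m h).

(* [sup] is used only for subsets of the unit polydisc, on which polynomials
   are bounded; [sup set0 = 0]. *)
Definition sup_norm (Y : set 'rV[F]_d) h : R :=
  sup [set absv (meval (coords y) h) | y in Y].

(* [mmeasure mdeg h] is the notation [msize h] of mpoly.v: one more than the
   total degree of [h], and 0 if h = 0. *)
Definition total_degree h : nat := (mmeasure mdeg h).-1.

End Polynomials.

(* Closedness is in F^d.  Requiring closedness relative to the open polydisc
   would be equivalent: intersect the i-th set with the points all of whose
   coordinates have norm at most 1 - 1/(i+1), which decreases the sup norms. *)
Definition perfect_interpolation (R : realType) (F : normedFieldType R) : Prop :=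
  forall (d : nat) (X : nat -> set 'rV[F]_d),
    (forall i, closed (X i)) ->
    (forall i, X i `<=` X i.+1) ->
    \bigcup_i X i = unit_polydisc (d := d) ->
    exists A B : nat -> R,
      [/\ B @ \oo --> (1 : R),
          forall i, 0 < A i
        & \forall i \near \oo, forall h : mpoly d F,
            coef_norm h <= A i * B i ^+ total_degree h * sup_norm (X i) h].

(* Formal power series in d variables, as families of coefficients. *)
Definition mseries (F : Type) (d : nat) : Type := multinom d -> F.

Section PowerSeries.
Context {R : realType} {F : normedFieldType R}.

Definition homogeneous_part d (f : mseries F d) (n : nat) : mpoly d F :=
  \sum_(m : bmultinom d n.+1 | mdeg m == n) f m *: mpolyX F m.

(* Coefficients of the one-variable series f(xz). *)
Definition line_series d (f : mseries F d) (x : 'rV[F]_d) : nat -> F :=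
  fun n => meval (coords x) (homogeneous_part f n).

(* Inversion in [\bar R] has 0^-1 = +oo and +oo^-1 = 0. *)
Definition convergence_radius (a : nat -> F) : \bar R :=
  ((limn_esup (fun n => (absv (a n) `^ (n%:R^-1))%:E))^-1)%E.

(* Convergence of the family of terms indexed by multi-indices is unordered:
   limit along the finite sets of multi-indices directed by inclusion. *)
Definition mseries_psum d (f : mseries F d) (x : 'rV[F]_d)
    (J : {fset multinom d}) : F :=
  summability.partial_sum (fun m => f m * mmap1 (coords x) m) J.

(* Meant for open [D]. *)
Definition analytic_on d (D : set 'rV[F]_d) (phi : 'rV[F]_d -> F) : Prop :=
  forall a, D a -> exists g : mseries F d,
    \forall x \near a,
      mseries_psum g (x - a) @ summability.totally --> phi x.

Definition defines_analytic d (f : mseries F d) : Prop :=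
  exists2 phi : 'rV[F]_d -> F,
    forall x, unit_polydisc x ->
      mseries_psum f x @ summability.totally --> phi x
    & analytic_on (unit_polydisc (d := d)) phi.

End PowerSeries.

(* Main.v *)
(* For s > 1 the points x with |x_j| <= 1 - 1/(i+1) at which |h_n(x)| <= s^n for
   all n >= i form closed sets increasing to the polydisc, so perfect
   interpolation at one large index bounds ||h_n|| by C q^n, where q = s^2 > 1 is
   arbitrary.  Hence the sum of |f_m| t^|m| is finite for every t < 1, and f
   converges absolutely on the polydisc.  Around a, expanding each (a + y)^m
   turns f into a family indexed by pairs of multi-indices that is absolutely
   summable for small y; summing it first over m gives the Taylor coefficients
   at a, and Fubini for unordered sums shows that both orders agree. *)
Require Import Defs.
From mathcomp Require Import all_boot all_order all_algebra.
From mathcomp Require Import finmap.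
From mathcomp Require Import -(notations) mpoly.
From mathcomp Require Import boolp classical_sets reals ereal topology.
From mathcomp Require Import normedtype sequences exp.
From mathcomp Require Import lra.
From mathcomp.analysis.showcase Require summability.

Set Implicit Arguments.
Unset Strict Implicit.
Unset Printing Implicit Defensive.

Import Order.TTheory GRing.Theory Num.Theory.
Import numFieldNormedType.Exports.

Local Open Scope classical_set_scope.
Local Open Scope ring_scope.

(** * Absolute values, convergence in their metric, and continuity of polynomials *)

Section AbsoluteValue.
Context {R : realType} {F : normedFieldType R}.
Implicit Types x y : F.

Lemma absv0 : absv (0 : F) = 0.
Proof. exact/absv_eq0. Qed.

Lemma absv1 : absv (1 : F) = 1.
Proof.
have n0 : absv (1 : F) != 0.
  by apply/eqP => /absv_eq0/eqP; rewrite oner_eq0.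
by apply: (mulfI n0); rewrite -absvM !mulr1.
Qed.

Lemma absvN x : absv (- x) = absv x.
Proof.
have h : absv (-1 : F) = 1.
  have : absv (-1 : F) ^+ 2 = 1 by rewrite expr2 -absvM mulrNN mulr1 absv1.
  move/eqP; rewrite sqrf_eq1 => /orP[/eqP //|/eqP h].
  by have := absv_ge0 (-1 : F); rewrite h ler0N1.
by rewrite -mulN1r absvM h mul1r.
Qed.

Lemma absv_distC x y : absv (x - y) = absv (y - x).
Proof. by rewrite -absvN opprB. Qed.

Lemma absv_distD y x z : absv (x - z) <= absv (x - y) + absv (y - z).
Proof. by rewrite -[x - z](subrKA y) absv_triangle. Qed.

Lemma absv_dist_absv x y : `|absv x - absv y| <= absv (x - y).
Proof.
rewrite ler_norml; apply/andP; split.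
  by have := absv_triangle (y - x) x; rewrite subrK absv_distC; lra.
by have := absv_triangle (x - y) y; rewrite subrK; lra.
Qed.

Lemma absvX x n : absv (x ^+ n) = absv x ^+ n.
Proof. by elim: n => [|n IH]; rewrite ?expr0 ?absv1// !exprS absvM IH. Qed.

Lemma absv_prod (I : Type) (r : seq I) (u : I -> F) :
  absv (\prod_(i <- r) u i) = \prod_(i <- r) absv (u i).
Proof. by apply: (big_morph absv (@absvM _ _)); exact: absv1. Qed.

Lemma absv_sum (I : Type) (r : seq I) (P : pred I) (u : I -> F) :
  absv (\sum_(i <- r | P i) u i) <= \sum_(i <- r | P i) absv (u i).
Proof.
elim/big_ind2: _ => //; first by rewrite absv0.
by move=> x1 x2 y1 y2 h1 h2; rewrite (le_trans (absv_triangle _ _))// lerD.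
Qed.

Lemma absv_unique x y : (forall e, 0 < e -> absv (x - y) < e) -> x = y.
Proof.
move=> h; apply/subr0_eq/absv_eq0/eqP/negPn/negP => n0.
have /h : 0 < absv (x - y) by rewrite lt_neqAle eq_sym n0 absv_ge0.
by rewrite ltxx.
Qed.

Lemma entourage_absvP (E : set (F * F)) :
  entourage E <-> exists2 e, 0 < e & forall x y, absv (x - y) < e -> E (x, y).
Proof.
rewrite entourage_absv; split => -[e e0 h]; exists e => //.
  by move=> x y xy; apply: h.
by case=> x y; exact: h.
Qed.

Lemma cvg_absvP (T : Type) (G : set_system T) (FG : Filter G) (u : T -> F) l :
  u @ G --> l <-> forall e, 0 < e -> \forall t \near G, absv (l - u t) < e.
Proof.
rewrite cvg_entourageP; split=> h.
  move=> e e0; apply: (h [set xy | absv (xy.1 - xy.2) < e]).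
  by apply/entourage_absvP; exists e.
move=> A /entourage_absvP[e e0 hA]; apply: filterS (h _ e0) => t; exact: hA.
Qed.

Lemma cauchy_absv (u : nat -> F) :
  (forall e, 0 < e -> exists N, forall m n, (N <= m)%N -> (N <= n)%N ->
     absv (u m - u n) < e) ->
  cauchy (u @ \oo).
Proof.
move=> h A /entourage_absvP[e e0 hA]; have [N hN] := h _ e0.
exists ([set u n | n in [set n | (N <= n)%N]],
        [set u n | n in [set n | (N <= n)%N]]) => /=.
  by split; exists N => // n Nn; exists n.
case=> x y [[/= m Nm mx] [/= n Nn ny]].
by apply: hA; rewrite -mx -ny; exact: hN.
Qed.

Lemma cvg_absvD (T : Type) (G : set_system T) (FG : Filter G) (u v : T -> F) a b :
  u @ G --> a -> v @ G --> b -> (fun t => u t + v t) @ G --> a + b.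
Proof.
move=> /cvg_absvP hu /cvg_absvP hv; apply/cvg_absvP => e e0.
have e20 : 0 < e / 2 by rewrite divr_gt0.
apply: filterS2 (hu _ e20) (hv _ e20) => t h1 h2.
rewrite opprD addrACA (le_lt_trans (absv_triangle _ _))//.
by rewrite [e]splitr ltrD.
Qed.

Lemma cvg_absvM (T : Type) (G : set_system T) (FG : Filter G) (u v : T -> F) a b :
  u @ G --> a -> v @ G --> b -> (fun t => u t * v t) @ G --> a * b.
Proof.
move=> /cvg_absvP hu /cvg_absvP hv; apply/cvg_absvP => e e0.
have a0 := absv_ge0 a; have b0 := absv_ge0 b.
(* [c] dominates [absv b] and, once [u t] is within 1 of [a], also [absv (u t)]; hence the 1 in the
   minimum defining [e']. *)
pose c := 1 + absv a + absv b.
have c0 : 0 < c by rewrite /c; lra.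
pose e' := Num.min 1 (e / (2 * c)).
have e'0 : 0 < e' by rewrite lt_min ltr01 divr_gt0// mulr_gt0.
apply: filterS2 (hu _ e'0) (hv _ e'0) => t h1 h2.
have -> : a * b - u t * v t = (a - u t) * b + u t * (b - v t).
  by rewrite mulrBl mulrBr addrA subrK.
have ut : absv (u t) <= c.
  have := absv_triangle (u t - a) a; rewrite subrK absv_distC.
  have : e' <= 1 by rewrite ge_min lexx.
  rewrite /c; lra.
rewrite (le_lt_trans (absv_triangle _ _))// !absvM.
have h3 : absv (a - u t) * absv b <= absv (a - u t) * c.
  by rewrite ler_wpM2l ?absv_ge0// /c; lra.
have h4 : absv (u t) * absv (b - v t) <= c * absv (b - v t).
  by rewrite ler_wpM2r ?absv_ge0.
have h5 : absv (a - u t) * c < e' * c by rewrite ltr_pM2r.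
have h6 : c * absv (b - v t) < c * e' by rewrite ltr_pM2l.
have h7 : e' * c <= e / 2.
  rewrite -ler_pdivlMr// (le_trans _ (_ : e / (2 * c) <= _))//.
    by rewrite ge_min lexx orbT.
  by rewrite invfM mulrA.
rewrite (mulrC c) in h6.
lra.
Qed.

Lemma cvg_absv (T : Type) (G : set_system T) (FG : Filter G) (u : T -> F) a :
  u @ G --> a -> (fun t => absv (u t)) @ G --> absv a.
Proof.
move=> /cvg_absvP hu; apply/cvgrPdist_lt => e e0.
by apply: filterS (hu _ e0) => t; apply: le_lt_trans; exact: absv_dist_absv.
Qed.

Lemma cvg_coord d (a : 'rV[F]_d) j : (fun x : 'rV[F]_d => x 0 j) @ a --> a 0 j.
Proof.
(* A neighbourhood of a matrix is a family of neighbourhoods of its entries; this family constrains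
   entry [j] alone. *)
move=> A hA; exists (fun _ k => [set y | k = j -> A y]) => [i k|M hM] /=.
  case: (eqVneq k j) => [->|kj].
    by rewrite (ord1 i); apply: filterS hA => y Ay _.
  by apply: filterS filterT => y _ kE; rewrite kE eqxx in kj.
exact: hM.
Qed.

(** Evaluation is a sum over the support of products of powers of coordinates; three nested
    inductions reduce its continuity to constants and coordinate maps. *)
Lemma cvg_meval d (h : mpoly d F) (a : 'rV[F]_d) :
  (fun x : 'rV[F]_d => meval (coords x) h) @ a --> meval (coords a) h.
Proof.
have cst (G : 'rV[F]_d -> F) c : G =1 (fun=> c) -> G @ a --> c.
  move=> Gc; apply/(cvg_absvP (nbhs_filter a)) => e e0.
  by apply: nearW => x; rewrite Gc subrr absv0.
rewrite /meval /mmap; elim: (msupp h) => [|m s IH].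
  by rewrite big_nil; apply: cst => x; rewrite big_nil.
rewrite big_cons; under eq_cvg do rewrite big_cons.
apply: (cvg_absvD (nbhs_filter a)) => //; apply: (cvg_absvM (nbhs_filter a)); first exact: cst.
rewrite /mmap1; elim: (index_enum _) => [|i r IHr].
  by rewrite big_nil; apply: cst => x; rewrite big_nil.
rewrite big_cons; under eq_cvg do rewrite big_cons.
apply: (cvg_absvM (nbhs_filter a)) => //; elim: (m i) => [|n IHn]; first exact: cst.
rewrite exprS; under eq_cvg do rewrite exprS.
by apply: (cvg_absvM (nbhs_filter a)) => //; exact: cvg_coord.
Qed.

Lemma closed_meval_le d (h : mpoly d F) (c : R) :
  closed [set x : 'rV[F]_d | absv (meval (coords x) h) <= c].
Proof.
apply: (@preimage_closed _ R (fun x : 'rV[F]_d => absv (meval (coords x) h))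
  [set r | r <= c]) => [x _|]; last exact: closed_le.
by apply: (cvg_absv (nbhs_filter x)); exact: cvg_meval.
Qed.

End AbsoluteValue.

(** * From radius of convergence to growth of coefficients *)

Section Sequences.
Context {R : realType} {F : normedFieldType R}.

(** A radius at least 1 means that the limsup of the n-th roots is at most 1, hence below [q], so
    some tail of the roots has supremum below [q]. *)
Lemma convergence_radius_ge1 (a : nat -> F) (q : R) : 1 < q ->
  (1 <= convergence_radius a)%E ->
  exists N, forall n, (N <= n)%N -> absv (a n) <= q ^+ n.
Proof.
rewrite /convergence_radius; set L := limn_esup _ => q1 h.
have L0 : (0 <= L)%E by rewrite -inve_ge0 (le_trans _ h).
have : (L < q%:E)%E by rewrite (@le_lt_trans _ _ 1%E) ?lte_fin// -inve_ge1.
rewrite /L /limn_esup limf_esupE => /ereal_inf_lt[_ [V [N _ NV] <-]] supV.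
(* The shift by one discards index 0, where the exponent is [0^-1 = 0] and the root carries no
   information on [a 0]. *)
exists N.+1 => -[//|n] Nn; have := NV n.+1 (ltnW Nn).
move=> Vn; have : absv (a n.+1) `^ (n.+1%:R^-1) <= q.
  rewrite -lee_fin (le_trans _ (ltW supV))//; apply: ereal_sup_ubound.
  by exists n.+1.
move=> {}h; have -> : absv (a n.+1) = (absv (a n.+1) `^ (n.+1%:R^-1)) ^+ n.+1.
  by rewrite -powR_mulrn ?powR_ge0// -powRrM mulVf// powRr1 ?absv_ge0.
by rewrite lerXn2r// nnegrE ?powR_ge0// (le_trans _ (ltW q1)).
Qed.

End Sequences.

(** * Unordered summation: existence, uniqueness and Fubini *)

Notation sums_to u l :=
  (summability.partial_sum u @ summability.totally --> l).

Lemma ler_sum_fset (R : realType) (I : choiceType) (J K : {fset I}) (u : I -> R) :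
  (forall i, 0 <= u i) -> (J `<=` K)%fset ->
  \sum_(i <- J) u i <= \sum_(i <- K) u i.
Proof.
move=> u0 JK; rewrite [leRHS](big_fsetID _ (mem J)) /=.
rewrite (_ : [fset x in K | x \in J]%fset = J) ?lerDl ?sumr_ge0//.
apply/fsetP => x; rewrite !inE /=; apply/andP/idP => [[]//|xJ].
by split=> //; exact: (fsubsetP JK).
Qed.

Lemma big_fsetM (R : zmodType) (I J : choiceType) (A : {fset I}) (B : {fset J})
    (v : I * J -> R) :
  \sum_(p <- (A `*` B)%fset) v p = \sum_(i <- A) \sum_(j <- B) v (i, j).
Proof.
by rewrite big_imfset2 => [|[? ?] [? ?] _ _ /= [-> ->]].
Qed.

Section UnorderedSums.
Context {R : realType} {F : normedFieldType R}.

Lemma sums_toP (I : choiceType) (u : I -> F) (l : F) : sums_to u l <->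
  forall e, 0 < e -> exists J0 : {fset I}, forall J, (J0 `<=` J)%fset ->
    absv (l - \sum_(i <- J) u i) < e.
Proof.
have sumE J : summability.partial_sum u J = \sum_(i <- J) u i.
  by rewrite big_seq_fsetE.
have := cvg_absvP (@summability.totally_filter I) (summability.partial_sum u) l.
move=> ->; split=> h e /h; first by case=> J0 _ hJ; exists J0 => J /hJ /=; rewrite sumE.
by case=> J0 hJ; exists J0 => // J /hJ; rewrite /= sumE.
Qed.

Lemma sums_to_unique (I : choiceType) (u : I -> F) (l l' : F) :
  sums_to u l -> sums_to u l' -> l = l'.
Proof.
move=> /sums_toP h /sums_toP h'; apply: absv_unique => e e0.
have e20 : 0 < e / 2 by rewrite divr_gt0.
have [J hJ] := h _ e20; have [J' hJ'] := h' _ e20.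
have {}hJ := hJ _ (fsubsetUl J J'); have {}hJ' := hJ' _ (fsubsetUr J J').
rewrite (le_lt_trans (absv_distD (\sum_(i <- (J `|` J')%fset) u i) _ _))//.
by rewrite [e]splitr ltrD// absv_distC.
Qed.

Lemma sums_to_finite (I : choiceType) (u : I -> F) (s : seq I) : uniq s ->
  (forall i, i \notin s -> u i = 0) -> sums_to u (\sum_(i <- s) u i).
Proof.
move=> us u0; apply/sums_toP => e e0; exists [fset i in s]%fset => J sJ.
rewrite -(big_fset_incl _ sJ) => [|x _]; last by rewrite !inE => /u0.
by rewrite big_imfset//= undup_id// subrr absv0.
Qed.

Lemma sums_toZ (I : choiceType) (u : I -> F) (l c : F) :
  sums_to u l -> sums_to (fun i => u i * c) (l * c).
Proof.
move=> /sums_toP h; apply/sums_toP => e e0.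
have c0 : 0 < absv c + 1 by rewrite ltr_wpDl ?absv_ge0.
have [|J0 hJ] := h (e / (absv c + 1)); first by rewrite divr_gt0.
exists J0 => J /hJ {}hJ; rewrite -mulr_suml -mulrBl absvM.
rewrite ltr_pdivlMr// in hJ; apply: le_lt_trans hJ.
by rewrite ler_wpM2l ?absv_ge0// lerDl.
Qed.

(** Completeness concerns sequences whereas the sum is a limit along finite sets. Finite sets [K n]
    with tails below 1/(n+1) give a Cauchy sequence of partial sums, and its limit is the limit
    along all finite sets. *)
Lemma absv_sums_to (hc : complete_field F) (I : choiceType) (u : I -> F) (M : R) :
  (forall J : {fset I}, \sum_(i <- J) absv (u i) <= M) ->
  exists l : F, sums_to u l.
Proof.
move=> hM; pose S := [set \sum_(i <- J) absv (u i) | J in @setT {fset I}].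
have ubS : has_ubound S by exists M => _ [J _ <-].
have supS : has_sup S.
  by split => //; exists (\sum_(i <- fset0) absv (u i)); exists fset0.
have tail e : 0 < e -> exists J0 : {fset I}, forall J, (J0 `<=` J)%fset ->
    absv (\sum_(i <- J) u i - \sum_(i <- J0) u i) < e.
  (* [J0] has absolute sum within [e] of the supremum, so less than [e] is left for any finite set
     disjoint from it. *)
  move=> e0; have [_ [J0 _ <-] hJ0] := sup_adherent e0 supS.
  exists J0 => J JJ.
  have split_sum (G : zmodType) (w : I -> G) :
      \sum_(i <- J) w i = \sum_(i <- J0) w i + \sum_(i <- (J `\` J0)%fset) w i.
    rewrite (big_fsetID _ (mem J0)) /=; congr (_ + _); apply: eq_fbigl => i.
      by rewrite !inE /=; apply/andP/idP => [[]//|iJ]; split=> //; apply: (fsubsetP JJ).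
    by rewrite !inE /= andbC.
  rewrite split_sum addrC addKr (le_lt_trans (absv_sum _ _ _))//.
  have : \sum_(i <- J) absv (u i) <= sup S by apply: ub_le_sup => //; exists J.
  by rewrite split_sum; lra.
have pos n : 0 < (n.+1%:R : R)^-1 by rewrite invr_gt0.
have [K hK] := choice (fun n => tail _ (pos n)).
have small e : 0 < e -> exists N, forall n, (N <= n)%N -> (n.+1%:R : R)^-1 < e.
  move=> e0; have /cvgrPdist_lt/(_ _ e0)[N _ hN] := @cvg_harmonic R.
  exists N => n /hN /=; rewrite sub0r normrN ger0_norm//; exact: ltW.
have [l hl] : exists l : F, (fun n => \sum_(i <- K n) u i) @ \oo --> l.
  apply: hc; apply: cauchy_absv => e e0.
  have e20 : 0 < e / 2 by rewrite divr_gt0.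
  have [N hN] := small _ e20; exists N => m n Nm Nn.
  (* [K m] and [K n] need not be nested, so both sums are compared with the one over the union. *)
  rewrite (le_lt_trans (absv_distD (\sum_(i <- (K m `|` K n)%fset) u i) _ _))//.
  rewrite [e]splitr ltrD//.
    by rewrite absv_distC (lt_trans (hK m _ (fsubsetUl _ _)))// hN.
  by rewrite (lt_trans (hK n _ (fsubsetUr _ _)))// hN.
exists l; apply/sums_toP => e e0; have e20 : 0 < e / 2 by rewrite divr_gt0.
have [N hN] := small _ e20.
move/cvg_absvP : hl => /(_ _ e20)[N' _ hN'].
exists (K (maxn N N')) => J KJ.
rewrite (le_lt_trans (absv_distD (\sum_(i <- K (maxn N N')) u i) _ _))//.
rewrite [e]splitr ltrD//; first by apply: hN'; rewrite /= leq_maxr.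
by rewrite absv_distC (lt_trans (hK _ _ KJ))// hN// leq_maxl.
Qed.

Lemma sums_to_swap (I J : choiceType) (v : I * J -> F) (l : F) :
  sums_to v l -> sums_to (fun p : J * I => v (p.2, p.1)) l.
Proof.
move=> /sums_toP h; apply/sums_toP => e /h[K0 hK].
exists [fset (p.2, p.1) | p in K0]%fset => K K0K.
have := hK [fset (p.2, p.1) | p in K]%fset.
rewrite big_imfset /=; last by move=> [? ?] [? ?] _ _ [-> ->].
apply; apply/fsubsetP => -[i j] ij; apply/imfsetP; exists (j, i) => //=.
by apply: (fsubsetP K0K); apply/imfsetP; exists (i, j).
Qed.

(** Fubini in one direction: over a large finite rectangle the double sum is near [l], and each of
    its finitely many rows is near [s i]. *)
Lemma sums_to_iterated (I J : choiceType) (v : I * J -> F) (s : I -> F) (l : F) :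
  sums_to v l -> (forall i, sums_to (fun j => v (i, j)) (s i)) -> sums_to s l.
Proof.
move=> /sums_toP h hs; apply/sums_toP => e e0.
have e20 : 0 < e / 2 by rewrite divr_gt0.
have [K0 hK] := h _ e20.
exists [fset p.1 | p in K0]%fset => A K0A.
(* The error is shared among the rows of [A]; the successor keeps the divisor positive when [A] is
   empty. *)
have e'0 : 0 < e / 2 / (#|` A|.+1)%:R by rewrite divr_gt0.
have /choice[B hB] i : exists B0 : {fset J}, forall B, (B0 `<=` B)%fset ->
    absv (s i - \sum_(j <- B) v (i, j)) < e / 2 / (#|` A|.+1)%:R.
  by have /sums_toP/(_ _ e'0) := hs i.
(* With these columns the rectangle contains [K0], and every row indexed by [A] contains its own
   [B i]. *)
pose C := ([fset p.2 | p in K0] `|` \bigcup_(i <- A) B i)%fset.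
have hC : absv (l - \sum_(i <- A) \sum_(j <- C) v (i, j)) < e / 2.
  rewrite -big_fsetM; apply: hK; apply/fsubsetP => -[i j] ij.
  rewrite in_fsetM /=; apply/andP; split.
    by apply: (fsubsetP K0A); apply/imfsetP; exists (i, j).
  by rewrite inE; apply/orP; left; apply/imfsetP; exists (i, j).
have hA : absv (\sum_(i <- A) \sum_(j <- C) v (i, j) - \sum_(i <- A) s i) <= e / 2.
  rewrite -sumrB (le_trans (absv_sum _ _ _))//.
  apply: (@le_trans _ _ (\sum_(i <- A) e / 2 / (#|` A|.+1)%:R)).
    rewrite big_seq [leRHS]big_seq; apply: ler_sum => i iA.
    rewrite absv_distC; apply/ltW/hB/fsubsetP => j jB.
    rewrite inE; apply/orP; right; apply/bigfcupP; exists i => //.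
    by rewrite iA.
  rewrite big_const_seq count_predT iter_addr_0 -[X in X <= _]mulr_natr mulrAC.
  rewrite ler_pdivrMr ?ltr0n// ler_wpM2l ?(ltW e20)// ler_nat.
  exact: leqnSn.
rewrite (le_lt_trans (absv_distD (\sum_(i <- A) \sum_(j <- C) v (i, j)) _ _))//.
by rewrite [e]splitr ltr_leD.
Qed.

End UnorderedSums.

(** * Weighted coefficient norms and translated monomials *)

Section WeightedNorm.
Context {R : realType} {F : normedFieldType R} {d : nat}.
Implicit Types (p q : mpoly d F) (r : R).

(** The l^1 norm attached to the polydisc of radius [r]; it is submultiplicative for [r]
    nonnegative. *)
Definition weighted_norm r p : R :=
  \sum_(m <- msupp p) absv (mcoeff m p) * r ^+ mdeg m.

(** Zero coefficients contribute nothing; this lets polynomials with different supports be summed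
    over a common list. *)
Lemma weighted_normE r p (s : seq (multinom d)) :
  uniq s -> {subset msupp p <= s} ->
  weighted_norm r p = \sum_(m <- s) absv (mcoeff m p) * r ^+ mdeg m.
Proof.
move=> us ps; rewrite (bigID (mem (msupp p))) /= [X in _ + X]big1 ?addr0.
  rewrite -big_filter; apply: perm_big; apply: uniq_perm.
  - exact: msupp_uniq.
  - exact: filter_uniq.
  move=> m; rewrite mem_filter; apply/idP/andP => [mp|[]//].
  by split=> //; exact: ps.
by move=> m /memN_msupp_eq0 ->; rewrite absv0 mul0r.
Qed.

Lemma ler_weighted_norm r p (s : seq (multinom d)) : 0 <= r -> uniq s ->
  \sum_(m <- s) absv (mcoeff m p) * r ^+ mdeg m <= weighted_norm r p.
Proof.
move=> r0 us; have nneg m : 0 <= absv (mcoeff m p) * r ^+ mdeg m.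
  by rewrite mulr_ge0 ?absv_ge0 ?exprn_ge0.
rewrite (@weighted_normE r p (s ++ [seq m <- msupp p | m \notin s])).
- by rewrite big_cat /= lerDl sumr_ge0.
- rewrite cat_uniq us filter_uniq ?msupp_uniq// andbT /=.
  by apply/hasPn => m; rewrite mem_filter => /andP[].
- by move=> m mp; rewrite mem_cat mem_filter mp andbT orbN.
Qed.

Lemma weighted_normD r p q : 0 <= r ->
  weighted_norm r (p + q) <= weighted_norm r p + weighted_norm r q.
Proof.
move=> r0; pose s := undup (msupp p ++ msupp q).
have us : uniq s by exact: undup_uniq.
rewrite !(weighted_normE r us); last first.
- by move=> m /msuppD_le; rewrite mem_undup.
- by move=> m mp; rewrite mem_undup mem_cat mp.
- by move=> m mp; rewrite mem_undup mem_cat mp orbT.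
rewrite -big_split; apply: ler_sum => m _ /=.
by rewrite -mulrDl mcoeffD ler_wpM2r ?exprn_ge0 ?absv_triangle.
Qed.

Lemma weighted_norm0 r : weighted_norm r 0 = 0.
Proof. by rewrite /weighted_norm msupp0 big_nil. Qed.

Lemma weighted_norm_sum r (I : Type) (s : seq I) (u : I -> mpoly d F) : 0 <= r ->
  weighted_norm r (\sum_(i <- s) u i) <= \sum_(i <- s) weighted_norm r (u i).
Proof.
move=> r0; elim: s => [|i s IH]; first by rewrite !big_nil weighted_norm0.
by rewrite !big_cons (le_trans (weighted_normD _ _ _))// lerD2l.
Qed.

Lemma weighted_normZX r c m :
  weighted_norm r (c *: mpolyX F m) = absv c * r ^+ mdeg m.
Proof.
rewrite (@weighted_normE r _ [:: m])//; last first.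
  by move=> k /msuppZ_le; rewrite msuppX.
by rewrite big_seq1 mcoeffZ mcoeffX eqxx mulr1.
Qed.

(** Expand into products of terms: the norm is multiplicative on single terms, and the triangle
    inequality absorbs the collection of equal monomials. *)
Lemma weighted_normM r p q : 0 <= r ->
  weighted_norm r (p * q) <= weighted_norm r p * weighted_norm r q.
Proof.
move=> r0; rewrite mpolyME (le_trans (weighted_norm_sum _ _ r0))//.
rewrite big_allpairs /weighted_norm mulr_suml; apply: ler_sum => m _.
rewrite mulr_sumr; apply: ler_sum => k _.
by rewrite -/(weighted_norm _ _) weighted_normZX absvM mdegD exprD mulrACA.
Qed.

Lemma weighted_norm_ge0 r p : 0 <= r -> 0 <= weighted_norm r p.
Proof. by move=> r0; apply: sumr_ge0 => m _; rewrite mulr_ge0 ?absv_ge0 ?exprn_ge0. Qed.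

Lemma weighted_normX r p n : 0 <= r ->
  weighted_norm r (p ^+ n) <= weighted_norm r p ^+ n.
Proof.
move=> r0; elim: n => [|n IH].
  have := weighted_normZX r 1 mnm0.
  by rewrite scale1r mpolyX0 mdeg0 !expr0 absv1 mulr1 => ->.
rewrite !exprS (le_trans (weighted_normM _ _ r0))//.
by rewrite ler_wpM2l ?weighted_norm_ge0.
Qed.

(** This is (X + a)^m, left as a product so that its Taylor coefficients are read off by [mcoeff]
    without binomial formulas. *)
Definition translated_monomial (a : 'I_d -> F) (m : multinom d) : mpoly d F :=
  \prod_(i < d) (mpolyX F (mnm1 i) + mpolyC d (a i)) ^+ m i.

Lemma meval_translated_monomial (a y : 'I_d -> F) m :
  meval y (translated_monomial a m) = mmap1 (fun i => y i + a i) m.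
Proof.
rewrite /translated_monomial rmorph_prod; apply: eq_bigr => i _.
by rewrite rmorphXn /= mevalD mevalXU mevalC.
Qed.

(* Submultiplicativity replaces the binomial expansion of (a + y)^m. *)
Lemma weighted_norm_translated_monomial r (t : R) (a : 'I_d -> F) m : 0 <= r ->
  (forall i, absv (a i) + r <= t) ->
  weighted_norm r (translated_monomial a m) <= t ^+ mdeg m.
Proof.
move=> r0 at_; rewrite mdegE -prodrXr /translated_monomial.
have h i : weighted_norm r (mpolyX F (mnm1 i) + mpolyC d (a i)) <= t.
  rewrite (le_trans (weighted_normD _ _ r0))//.
  have := weighted_normZX r 1 (mnm1 i); have := weighted_normZX r (a i) mnm0.
  rewrite scale1r mpolyX0 -mul_mpolyC mulr1 => -> ->.
  by rewrite mdeg1 mdeg0 expr0 expr1 absv1 mul1r mulr1 addrC.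
elim: (index_enum _) => [|i s IH].
  (* The empty product is 1, whose norm is bounded through the power lemma at exponent 0. *)
  have := weighted_normX 0 0 r0; rewrite !big_nil expr0 => /le_trans; exact.
rewrite !big_cons (le_trans (weighted_normM _ _ r0))// ler_pM ?weighted_norm_ge0//.
by rewrite (le_trans (weighted_normX _ _ r0))// lerXn2r// ?nnegrE ?weighted_norm_ge0//
  (le_trans _ (h i))// weighted_norm_ge0.
Qed.

End WeightedNorm.

(** * Growth of the homogeneous parts and absolute summability *)

Section Growth.
Context {R : realType} {F : normedFieldType R} {d : nat}.
Variable f : mseries F d.

Lemma coef_norm_weighted_norm (h : mpoly d F) : coef_norm h = weighted_norm 1 h.
Proof. by apply: eq_bigr => m _; rewrite expr1n mulr1. Qed.

Lemma mcoeff_homogeneous_part n m :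
  mcoeff m (homogeneous_part f n) = if mdeg m == n then f m else 0.
Proof.
rewrite /homogeneous_part raddf_sum /=; case: ifP => [/eqP mn|mn].
  have mb : (mdeg m < n.+1)%N by rewrite mn.
  rewrite (bigD1 (BMultinom mb)) /= ?mn// mcoeffZ mcoeffX eqxx mulr1.
  rewrite big1 ?addr0// => k /andP[_ km]; rewrite mcoeffZ mcoeffX.
  by rewrite bmeqP /= in km; rewrite (negPf km) mulr0.
rewrite big1// => k /eqP kn; rewrite mcoeffZ mcoeffX.
case: eqP => [km|_]; last by rewrite mulr0.
by rewrite -km kn eqxx in mn.
Qed.

(** Only an inequality, since a vanishing homogeneous part has total degree 0. *)
Lemma total_degree_homogeneous_part n :
  (total_degree (homogeneous_part f n) <= n)%N.
Proof.
rewrite /total_degree -subn1 leq_subLR add1n mmeasureE.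
apply/bigmax_leqP_seq => m; rewrite mcoeff_msupp mcoeff_homogeneous_part.
by case: ifP => [/eqP <-|_]; rewrite ?eqxx.
Qed.

Lemma coef_norm_growth (q : R) : perfect_interpolation F ->
  (forall x : 'rV[F]_d, unit_polydisc x ->
     (1 <= convergence_radius (line_series f x))%E) ->
  1 < q ->
  exists2 C, 0 <= C &
    forall n, coef_norm (homogeneous_part f n) <= C * q ^+ n.
Proof.
(* One factor [s ^+ n] will come from the powers of [B i], the other from the sup norm on [X i]. *)
move=> hF hf q1; pose s := Num.sqrt q.
have q0 : 0 <= q by lra.
have s1 : 1 < s by rewrite -sqrtr1 ltr_sqrt// (lt_trans _ q1).
have sq n : s ^+ n * s ^+ n = q ^+ n by rewrite -exprMn -expr2 sqr_sqrtr.
(* The shrinking margin in the first condition keeps [X i] inside the open polydisc while closed in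
   the whole space. *)
pose X i : set 'rV[F]_d :=
  [set x | (forall j, absv (coords x j) <= 1 - i.+1%:R^-1) /\
     (forall n, (i <= n)%N -> absv (line_series f x n) <= s ^+ n)].
have closedX i : closed (X i).
  have -> : X i =
    (\bigcap_(j in setT) [set x : 'rV[F]_d |
       absv (meval (coords x) (mpolyX F (mnm1 j))) <= 1 - i.+1%:R^-1]) `&`
    (\bigcap_(n in [set n | (i <= n)%N]) [set x : 'rV[F]_d |
       absv (meval (coords x) (homogeneous_part f n)) <= s ^+ n]).
    apply/seteqP; split => x [h1 h2]; split => //.
      by move=> j _ /=; rewrite mevalXU.
    by move=> j; have := h1 j I; rewrite /= mevalXU.
  by apply: closedI; apply: closed_bigI => ? _; exact: closed_meval_le.
have incX i : X i `<=` X i.+1.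
  move=> x [h1 h2]; split => [j|n ni]; last by apply: h2; exact: ltnW.
  rewrite (le_trans (h1 j))// lerD2l lerN2 lef_pV2 ?posrE// ler_nat.
  exact: leqnSn.
have covX : \bigcup_i X i = unit_polydisc (d := d).
  apply/seteqP; split => [x [i _ [h1 _]] j|x hx].
    by rewrite (le_lt_trans (h1 j))// ltrBlDr ltrDl invr_gt0.
  have [N hN] := convergence_radius_ge1 s1 (hf x hx).
  have /choice[M hM] j : exists M, absv (coords x j) <= 1 - M.+1%:R^-1.
    have e0 : 0 < 1 - absv (coords x j) by rewrite subr_gt0; exact: hx.
    have /cvgrPdist_lt/(_ _ e0)[M _ /(_ M (leqnn _))] := @cvg_harmonic R.
    rewrite /= sub0r normrN ger0_norm => [h|]; last by rewrite invr_ge0.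
    by exists M; rewrite lerBrDr -lerBrDl ltW.
  (* The sum exceeds all the thresholds at once: [N] for the growth and [M j] for each
     coordinate. *)
  exists (N + \sum_j M j)%N => //; split => [j|n Nn]; last first.
    by apply: hN; rewrite (leq_trans _ Nn)// leq_addr.
  rewrite (le_trans (hM j))// lerD2l lerN2 lef_pV2 ?posrE// ler_nat ltnS.
  by rewrite (bigD1 j)//= addnCA leq_addr.
have [A [B [B1 A0 [N0 _ hAB]]]] := hF d X closedX incX covX.
have s10 : 0 < s - 1 by rewrite subr_gt0.
(* Distance below [s - 1] gives [B i <= s]; distance below 1 gives [0 <= B i], needed for
   monotonicity of powers. *)
move/cvgrPdist_lt : B1 => /(_ (Num.min 1 (s - 1))).
rewrite lt_min ltr01 s10 => /(_ isT)[N1 _ hB].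
pose i := maxn N0 N1.
have {}hAB := hAB i (leq_maxl _ _).
have {}hB : 0 <= B i <= s.
  have := hB i (leq_maxr _ _); rewrite /= lt_min !ltr_distl => /andP[].
  by move=> /andP[a1 a2] /andP[b1 b2]; apply/andP; split; lra.
have c0 n : 0 <= coef_norm (homogeneous_part f n).
  by rewrite coef_norm_weighted_norm weighted_norm_ge0.
(* Points of [X i] are controlled only in degrees at least [i]; the finitely many lower degrees are
   paid for by adding their norms. *)
exists (A i + \sum_(k < i) coef_norm (homogeneous_part f k)).
  by rewrite addr_ge0 ?(ltW (A0 i))// sumr_ge0.
have qn n : 1 <= q ^+ n by rewrite exprn_ege1// ltW.
move=> n; rewrite mulrDl; case: (ltnP n i) => ni.
  rewrite (bigD1 (Ordinal ni))//= (@le_trans _ _ (coef_norm (homogeneous_part f n) * q ^+ n))//.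
    by rewrite ler_peMr.
  rewrite mulrDl addrCA lerDl addr_ge0//.
    by rewrite mulr_ge0 ?(ltW (A0 i))// (le_trans ler01).
  by rewrite mulr_ge0 ?sumr_ge0// (le_trans ler01).
rewrite (le_trans (hAB _))// ler_wpDr//.
  by rewrite mulr_ge0 ?sumr_ge0// (le_trans ler01).
rewrite -mulrA ler_wpM2l ?(ltW (A0 i))// -sq.
case/andP: hB => B0 Bs; set b := B i ^+ _.
have bs : b <= s ^+ n.
  rewrite (le_trans (lerXn2r _ _ _ Bs)) ?nnegrE// ?(le_trans B0)//.
  by rewrite ler_weXn2l ?(ltW s1)// total_degree_homogeneous_part.
have sn0 : 0 <= s ^+ n by rewrite exprn_ge0// (le_trans B0).
apply: (@le_trans _ _ (b * s ^+ n)); last by rewrite ler_wpM2r.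
rewrite ler_wpM2l ?exprn_ge0// /sup_norm.
(* Bounding a supremum requires a point; if [X i] is empty, the sup norm is 0 by convention. *)
have [[y Xy]|X0] := pselect (exists y, X i y).
  apply: ge_sup; first by eexists; exists y.
  by move=> _ [x [_ hx] <-]; apply: hx.
rewrite (_ : X i = set0) ?image_set0 ?sup0//.
by apply/seteqP; split => // y Xy; case: X0; exists y.
Qed.

(** Grouping by total degree compares the sum with the geometric series of ratio [q * t]. *)
Lemma summable_of_growth (q C t : R) : 0 <= C -> 0 <= t -> 0 <= q -> q * t < 1 ->
  (forall n, coef_norm (homogeneous_part f n) <= C * q ^+ n) ->
  forall J : {fset multinom d},
    \sum_(m <- J) absv (f m) * t ^+ mdeg m <= C / (1 - q * t).
Proof.
move=> C0 t0 q0 qt h J; set w := q * t in qt *.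
have w0 : 0 <= w by rewrite mulr_ge0.
pose N := (\max_(m <- J) (mdeg m).+1)%N.
have -> : \sum_(m <- J) absv (f m) * t ^+ mdeg m =
    \sum_(n < N) \sum_(m <- J | mdeg m == n) absv (f m) * t ^+ mdeg m.
  under [RHS]eq_bigr do rewrite big_mkcond.
  rewrite exchange_big /= big_seq [RHS]big_seq; apply: eq_bigr => m mJ.
  have mN : (mdeg m < N)%N by apply: (leq_bigmax_seq (F := fun m => (mdeg m).+1)).
  rewrite (bigD1 (Ordinal mN))//= eqxx big1 ?addr0// => n nm.
  by case: eqP => // mn; case/eqP: nm; apply: val_inj.
apply: (@le_trans _ _ (\sum_(n < N) C * w ^+ n)).
  apply: ler_sum => n _.
  have -> : \sum_(m <- J | mdeg m == n) absv (f m) * t ^+ mdeg m =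
      (\sum_(m <- [seq m <- J | mdeg m == n])
        absv (mcoeff m (homogeneous_part f n)) * 1 ^+ mdeg m) * t ^+ n.
    rewrite big_filter mulr_suml; apply: eq_bigr => m /eqP mn.
    by rewrite mcoeff_homogeneous_part mn eqxx expr1n mulr1.
  rewrite exprMn mulrA ler_wpM2r ?exprn_ge0// (le_trans _ (h n))//.
  by rewrite coef_norm_weighted_norm ler_weighted_norm// filter_uniq// fset_uniq.
rewrite -mulr_sumr ler_wpM2l// -[X in _ <= X]mul1r ler_pdivlMr ?subr_gt0//.
(* The finite geometric sum times [1 - w] is [1 - w ^+ N], at most 1. *)
by rewrite mulrC -opprB mulNr -subrX1 opprB gerBl exprn_ge0.
Qed.

End Growth.

(** * Expansion around another centre, and the theorem *)

Section Recentring.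
Context {R : realType} {F : normedFieldType R} {d : nat}.
Variable f : mseries F d.

Lemma absv_mmap1_le (y : 'I_d -> F) (r : R) m :
  (forall i, absv (y i) <= r) -> absv (mmap1 y m) <= r ^+ mdeg m.
Proof.
move=> yr; rewrite /mmap1 absv_prod mdegE -prodrXr; apply: ler_prod => i _.
rewrite absvX exprn_ge0 ?absv_ge0//= lerXn2r// nnegrE ?absv_ge0//.
exact: le_trans (absv_ge0 _) (yr i).
Qed.

(** Enlarge [K] to a rectangle. For fixed [m], the sum over the second index is at most the weighted
    norm of (X + a)^m, hence at most [t ^+ mdeg m]. *)
Lemma ler_sum_translated (r t M : R) (a : 'I_d -> F) : 0 <= r ->
  (forall i, absv (a i) + r <= t) ->
  (forall J : {fset multinom d}, \sum_(m <- J) absv (f m) * t ^+ mdeg m <= M) ->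
  forall K : {fset multinom d * multinom d},
    \sum_(p <- K) absv (f p.1 * mcoeff p.2 (translated_monomial a p.1)) *
      r ^+ mdeg p.2 <= M.
Proof.
move=> r0 art hM K; pose A := [fset p.1 | p in K]%fset.
pose B := [fset p.2 | p in K]%fset.
have KAB : (K `<=` A `*` B)%fset.
  apply/fsubsetP => p pK; rewrite in_fsetM.
  by apply/andP; split; apply/imfsetP; exists p.
rewrite (le_trans (ler_sum_fset _ KAB))// => [p|].
  by rewrite mulr_ge0 ?absv_ge0 ?exprn_ge0.
rewrite big_fsetM (le_trans _ (hM A))//; apply: ler_sum => m _ /=.
under eq_bigr do rewrite absvM -mulrA.
rewrite -mulr_sumr ler_wpM2l ?absv_ge0//.
rewrite (le_trans (ler_weighted_norm _ r0 (fset_uniq B)))//.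
exact: weighted_norm_translated_monomial.
Qed.

End Recentring.

Theorem theorem5p2 (R : realType) (F : normedFieldType R)
    (hcomplete : complete_field F)
    (hF : perfect_interpolation F) (d : nat) (hd : (0 < d)%N)
    (f : mseries F d)
    (hf : forall x : 'rV[F]_d, unit_polydisc x ->
            (1 <= convergence_radius (line_series f x))%E) :
  defines_analytic f.
Proof.
have bounded t : 0 <= t < 1 -> exists M, forall J : {fset multinom d},
    \sum_(m <- J) absv (f m) * t ^+ mdeg m <= M.
  move=> /andP[t0 t1]; have t2 : 0 < 1 + t by lra.
  (* For [t < 1] this choice satisfies both [1 < q] and [q * t < 1]. *)
  have q1 : 1 < 2 / (1 + t) by rewrite ltr_pdivlMr//; lra.
  have [C C0 hC] := coef_norm_growth hF hf q1.
  have qt : 2 / (1 + t) * t < 1.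
    by rewrite mulrAC ltr_pdivrMr//; lra.
  eexists; apply: summable_of_growth qt hC => //; lra.
have radius (x : 'rV[F]_d) : unit_polydisc x ->
    exists2 t, 0 <= t < 1 & forall i, absv (coords x i) <= t.
  move=> hx; exists (\big[Num.max/0]_i absv (coords x i)).
    by rewrite bigmax_ge_id bigmax_lt.
  by move=> i; rewrite le_bigmax.
have /choice[phi hphi] x : exists l : F, unit_polydisc x ->
    sums_to (fun m => f m * mmap1 (coords x) m) l.
  have [hx|] := pselect (unit_polydisc x); last by exists 0.
  have [t t01 xt] := radius _ hx; have [M hM] := bounded _ t01.
  have [|l hl] := absv_sums_to hcomplete (u := fun m => f m * mmap1 (coords x) m) (M := M).
    move=> J; rewrite (le_trans _ (hM J))//; apply: ler_sum => m _.
    by rewrite absvM ler_wpM2l ?absv_ge0 ?absv_mmap1_le.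
  by exists l.
exists phi => // a ha.
have [t0 /andP[t00 t01] at0] := radius _ ha.
(* [r] is half the distance from [t0] to 1, and [t = t0 + r] is still below 1. *)
pose r := (1 - t0) / 2; pose t := (1 + t0) / 2.
have r0 : 0 < r by rewrite /r; lra.
have [|M hM] := bounded t; first by rewrite /t; apply/andP; split; lra.
have art i : absv (coords a i) + r <= t by have := at0 i; rewrite /r /t; lra.
have bound := ler_sum_translated (ltW r0) art hM.
pose T := translated_monomial (coords a).
(* [g k] is the Taylor coefficient at [a]: the coefficients of y^k in all (a + y)^m, weighted by
   [f m]. Its convergence is the double bound restricted to the column [k]. *)
have /choice[g hg] k : exists l : F, sums_to (fun m => f m * mcoeff k (T m)) l.
  apply: (absv_sums_to hcomplete (M := M / r ^+ mdeg k)) => J.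
  rewrite ler_pdivlMr ?exprn_gt0// mulr_suml.
  have := bound (J `*` [fset k])%fset; rewrite big_fsetM.
  by under eq_bigr do rewrite big_seq_fset1.
exists g.
have near_a : nbhs a [set x : 'rV[F]_d | forall j, absv (a 0 j - x 0 j) < r].
  exists (fun _ j => [set y | absv (a 0 j - y) < r]) => [i j|x hx] /=.
    rewrite (ord1 i).
    exact: (cvg_absvP (nbhs_filter (a 0 j)) id (a 0 j)).1 (fun _ h => h) _ r0.
  by move=> j; exact: hx.
apply: filterS near_a => x xa; pose y := coords (x - a).
have yr i : absv (y i) <= r.
  by rewrite /y /coords !mxE absv_distC ltW.
have yaE i : y i + coords a i = coords x i by rewrite /y /coords !mxE subrK.
have hx : unit_polydisc x.
  move=> j; rewrite -yaE (le_lt_trans (absv_triangle _ _))//.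
  by have := yr j; have := art j; rewrite /t; lra.
pose v (p : multinom d * multinom d) := f p.1 * mcoeff p.2 (T p.1) * mmap1 y p.2.
have [|l hl] := absv_sums_to hcomplete (u := v) (M := M).
  move=> K; rewrite (le_trans _ (bound K))//; apply: ler_sum => p _.
  by rewrite absvM ler_wpM2l ?absv_ge0 ?absv_mmap1_le.
(* Summing [v] over [k] first gives, for each [m], a finite sum equal to [f m] times the monomial at
   [x = y + a]. *)
have <- : l = phi x.
  apply: sums_to_unique (hphi x hx); apply: (sums_to_iterated hl) => m.
  have -> : f m * mmap1 (coords x) m = \sum_(k <- msupp (T m)) v (m, k).
    under eq_bigr do rewrite /v /= -mulrA; rewrite -mulr_sumr -mevalE.
    by rewrite meval_translated_monomial; congr (_ * _); exact: mmap1_eq.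
  apply: sums_to_finite; first exact: msupp_uniq.
  by move=> k kT; rewrite /v /= memN_msupp_eq0// mulr0 mul0r.
(* Summing the same family over [m] first gives [g k] times the monomial at [y]. *)
apply: (sums_to_iterated (sums_to_swap hl)) => k.
exact: sums_toZ (hg k).
Qed.
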